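(* Let $\mathbf{A}\in\mathbb{R}^{n\times n}$ be symmetric positive semidefinite, $\mathbf{B}\in\mathbb{R}^{n\times n}$ symmetric positive definite, $s\in\{1,\dots,n\}$ a sparsity level, and let $\{\mathbf{x}^{(t)}\}_{t\ge 1}$ be the sequence generated by the successive two-stage algorithm SA_GBA (described in the context) for the problem $\max\{R(\mathbf{x}):\mathbf{x}\in\mathbb{R}^n,\ \mathbf{x}\ne\mathbf{0},\ \|\mathbf{x}\|_0\le s\}$, started from an arbitrary $\hat{\mathbf{x}}^{(0)}\ne\mathbf{0}$ with $\|\hat{\mathbf{x}}^{(0)}\|_0\le s$. Then: (i) The sequence of objective values $\{R(\mathbf{x}^{(t)})\}$ strictly increases until the algorithm halts. (ii) The algorithm stops in at most $s$ iterations.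
   Context: Notation: $R(\mathbf{x}):=\dfrac{\mathbf{x}^\top\mathbf{A}\mathbf{x}}{\mathbf{x}^\top\mathbf{B}\mathbf{x}}$ for $\mathbf{x}\neq\mathbf{0}$; $\|\mathbf{x}\|_0$ is the number of nonzero entries of $\mathbf{x}$; $\mathcal{S}(\mathbf{x})=\{i:[\mathbf{x}]_i\ne 0\}$, $\mathcal{Z}(\mathbf{x})=\{i:[\mathbf{x}]_i=0\}$; $\mathbf{e}_i$ is the $i$-th standard basis vector. Call $\mathbf{x}$ feasible if $\mathbf{x}\ne\mathbf{0}$ and $\|\mathbf{x}\|_0\le s$. GBA: a (gradient-based) solver for the problem, regarded as a fixed deterministic map sending each feasible initial point $\mathbf{x}$ to a feasible output $\mathtt{GBA}(\mathbf{x})$, and monotone: $R(\mathtt{GBA}(\mathbf{x}))\ge R(\mathbf{x})$. SA (partial support alteration): for feasible $\mathbf{x}$ and an integer $0\le r\le\min\{\|\mathbf{x}\|_0,n-\|\mathbf{x}\|_0\}$, the vector $\mathtt{SA}(\mathbf{x},r)$ is defined as follows (with a fixed rule for breaking ties and choosing among maximizers). For a nonzero vector $\mathbf{z}$ and $j\neq i$ with $i\in\mathcal{Z}(\mathbf{z})$, let $\alpha^*_{(j,i),\mathbf{z}}$ be a maximizer over $\alpha\in\mathbb{R}$ of $\alpha\mapsto R(\mathbf{z}-[\mathbf{z}]_j\mathbf{e}_j+\alpha\mathbf{e}_i)$ (over those $\alpha$ where it is defined), written $\pm\infty$ if the supremum is not attained but only approached as $\alpha\to\pm\infty$; let $M_{(j,i),\mathbf{z}}$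 be the supremum of this function. Put $\tilde{\mathbf{x}}^{(0)}:=\mathbf{x}$. Let $j_1,\dots,j_r$ be the indices in $\mathcal{S}(\mathbf{x})$ of the $r$ entries of smallest absolute value, ordered so that $|[\mathbf{x}]_{j_1}|\le\dots\le|[\mathbf{x}]_{j_r}|$. For $t=1,\dots,r$: let $i_t$ maximize $M_{(j_t,i),\tilde{\mathbf{x}}^{(t-1)}}$ over $i\in\mathcal{Z}(\mathbf{x})\setminus\{i_1,\dots,i_{t-1}\}$; set $\tilde{\mathbf{x}}^{(t)}:=\tilde{\mathbf{x}}^{(t-1)}-[\tilde{\mathbf{x}}^{(t-1)}]_{j_t}\mathbf{e}_{j_t}+\alpha^*_{(j_t,i_t),\tilde{\mathbf{x}}^{(t-1)}}\mathbf{e}_{i_t}$ if $\alpha^*_{(j_t,i_t),\tilde{\mathbf{x}}^{(t-1)}}\ne\pm\infty$, and $\tilde{\mathbf{x}}^{(t)}:=\mathbf{e}_{i_t}$ otherwise. Then $\mathtt{SA}(\mathbf{x},r):=\tilde{\mathbf{x}}^{(r)}$. SS (self-adaptive step size): for feasible $\mathbf{x}$ and an integer $0\le\hat r\le\min\{\|\mathbf{x}\|_0,n-\|\mathbf{x}\|_0\}$, start with $r:=\hat r$; while $r\ne 0$ and $R(\mathtt{GBA}(\mathtt{SA}(\mathbf{x},r)))\le R(\mathbf{x})$, replace $r$ by $r-1$; the final $r$ is $\mathtt{SS}(\mathbf{x},\hat r)$. Algorithm SA_GBA: set $t:=0$ and choose a feasible $\hat{\mathbf{x}}^{(0)}$.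 Repeat: $t:=t+1$; (Stage 1) $\mathbf{x}^{(t)}:=\mathtt{GBA}(\hat{\mathbf{x}}^{(t-1)})$; (Stage 2) $\hat r_1:=\min\{\|\mathbf{x}^{(1)}\|_0,n-\|\mathbf{x}^{(1)}\|_0\}$ if $t=1$, and $\hat r_t:=\min\{r_{t-1}-1,\|\mathbf{x}^{(t)}\|_0,n-\|\mathbf{x}^{(t)}\|_0\}$ if $t\ge 2$; $r_t:=\mathtt{SS}(\mathbf{x}^{(t)},\hat r_t)$; $\hat{\mathbf{x}}^{(t)}:=\mathtt{SA}(\mathbf{x}^{(t)},r_t)$; until $r_t=0$. The output is $\mathbf{x}^{(t)}$.
   Formalization: In (ii), counting every pass of the loop, the bound s can fail (n=2, s=1, A=diag(1,2), B=I, GBA=identity, start e_1 takes 2 passes); what is proved is at most s+1 passes, i.e. at most s besides the final stopping pass, and at most s passes when n < 2s. *)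

(* Defs.v *)
From HB Require Import structures.
From mathcomp Require Import all_boot all_order all_algebra.
From mathcomp Require Import all_classical all_reals all_analysis.
Set Implicit Arguments.
Unset Strict Implicit.
Unset Printing Implicit Defensive.
Import Order.TTheory GRing.Theory Num.Theory.
Import numFieldNormedType.Exports.
Local Open Scope ring_scope.

Section Rayleigh.
Context {R : realType} {n : nat}.
Implicit Types (A B : 'M[R]_n) (x z : 'cV[R]_n) (i j : 'I_n).

Definition qform A x : R := (x^T *m A *m x) 0 0.

Definition psd A : Prop := A^T = A /\ forall x, 0 <= qform A x.

Definition posdef A : Prop := A^T = A /\ forall x, x != 0 -> 0 < qform A x.

Definition rayleigh A B x : R := qform A x / qform B x.

Definition supp x : {set 'I_n} := [set i | x i 0 != 0].

Definition zeros x : {set 'I_n} := [set i | x i 0 == 0].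

Definition norm0 x : nat := #|supp x|.

Definition feasible (s : nat) x : Prop := x != 0 /\ (norm0 x <= s)%N.

Definition evec i : 'cV[R]_n := delta_mx i 0.

Definition alter z j i (a : R) : 'cV[R]_n :=
  z - z j 0 *: evec j + a *: evec i.

(* The Rayleigh quotient along a |-> alter z j i a is defined exactly where
   that vector is nonzero.  The supremum is taken in \bar R, so that it needs
   no boundedness side condition. *)
Definition alter_sup A B z j i : \bar R :=
  ereal_sup [set (rayleigh A B (alter z j i a))%:E |
              a in [set a : R | alter z j i a != 0]]%classic.

Definition alter_argmax A B z j i (a : R) : Prop :=
  alter z j i a != 0 /\
  forall b : R, alter z j i b != 0 ->
    rayleigh A B (alter z j i b) <= rayleigh A B (alter z j i a).

Definition is_alpha_star A B z j i (alpha : \bar R) : Prop :=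
  match alpha with
  | EFin a => alter_argmax A B z j i a
  | +oo%E => (forall a, ~ alter_argmax A B z j i a) /\
      ((rayleigh A B (alter z j i a))%:E @[a --> +oo%R]
         --> alter_sup A B z j i)%classic
  | -oo%E => (forall a, ~ alter_argmax A B z j i a) /\
      ((rayleigh A B (alter z j i a))%:E @[a --> -oo%R]
         --> alter_sup A B z j i)%classic
  end.

End Rayleigh.

(* The choices left open by partial support alteration: in which order equal
   absolute values are listed, which maximizer alpha is used, and which
   maximizing index i is used. *)
Record sa_rule (R : realType) (n : nat) := SaRule {
  sa_order : 'cV[R]_n -> seq 'I_n;
  sa_alpha : 'cV[R]_n -> 'I_n -> 'I_n -> \bar R;
  sa_index : 'cV[R]_n -> 'I_n -> {set 'I_n} -> 'I_n
}.

Section Algorithm.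
Context {R : realType} {n : nat}.
Implicit Types (A B : 'M[R]_n) (x z : 'cV[R]_n) (i j : 'I_n).
Implicit Types (C : {set 'I_n}) (rule : sa_rule R n).

Definition sa_rule_valid A B rule : Prop :=
  [/\ forall x, perm_eq (sa_order rule x) (enum (supp x)) /\
        sorted (fun i j => `|x i 0| <= `|x j 0|) (sa_order rule x),
      forall z j i, z != 0 -> j != i -> i \in zeros z ->
        is_alpha_star A B z j i (sa_alpha rule z j i) &
      forall z j C, z != 0 -> C != finset.set0 -> C \subset zeros z -> j \notin C ->
        sa_index rule z j C \in C /\
        forall i, i \in C ->
          (alter_sup A B z j i <= alter_sup A B z j (sa_index rule z j C))%E].

(* C is the set of indices that may still enter the support, js the list of
   indices that remain to be removed from it. *)
Fixpoint sa_loop rule z C (js : seq 'I_n) : 'cV[R]_n :=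
  if js is j :: js' then
    let i := sa_index rule z j C in
    let z' := if sa_alpha rule z j i is EFin a then alter z j i a
              else evec i in
    sa_loop rule z' (C :\ i) js'
  else z.

Definition SA rule x (r : nat) : 'cV[R]_n :=
  sa_loop rule x (zeros x) (take r (sa_order rule x)).

Fixpoint SS A B rule (gba : 'cV[R]_n -> 'cV[R]_n) x (r : nat) : nat :=
  if r is r'.+1 then
    if rayleigh A B (gba (SA rule x r)) <= rayleigh A B x
    then SS A B rule gba x r' else r
  else 0%N.

Definition is_gba A B (s : nat) (gba : 'cV[R]_n -> 'cV[R]_n) : Prop :=
  forall x, feasible s x ->
    feasible s (gba x) /\ rayleigh A B x <= rayleigh A B (gba x).

(* Pass t (t >= 1) is executed iff no earlier pass met the stopping
   criterion. *)
Definition executed (r : nat -> nat) (t : nat) : Prop :=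
  (0 < t)%N /\ forall u : nat, (0 < u < t)%N -> r u != 0%N.

(* The stopping pass alters nothing: a run stopping at pass T makes T - 1
   iterations x t -> x t.+1.  "At most s iterations" cannot mean T <= s: with
   s = 1, n = 2, A = diag(1, 2), B = 1, gba = id and initial point e_0, the run
   stops at T = 2. *)
Definition stops_at (r : nat -> nat) (t : nat) : Prop :=
  executed r t /\ r t = 0%N.

Definition rhat (x : nat -> 'cV[R]_n) (r : nat -> nat) (t : nat) : nat :=
  let m := minn (norm0 (x t)) (n - norm0 (x t)) in
  if t == 1%N then m else minn (r t.-1).-1 m.

(* xh 0 is the initial point; x 0, r 0 and all the values after the stopping
   pass are meaningless and left unconstrained. *)
Definition sa_gba_run A B (s : nat) rule (gba : 'cV[R]_n -> 'cV[R]_n)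
    (xh x : nat -> 'cV[R]_n) (r : nat -> nat) : Prop :=
  feasible s (xh 0%N) /\
  forall t, executed r t ->
    [/\ x t = gba (xh t.-1),
        r t = SS A B rule gba (x t) (rhat x r t) &
        xh t = SA rule (x t) (r t)].

End Algorithm.

(* Main.v *)
Require Import Defs.
From HB Require Import structures.
From mathcomp Require Import all_boot all_order all_algebra.
From mathcomp Require Import all_classical all_reals all_analysis.
Import Order.TTheory GRing.Theory Num.Theory.
Local Open Scope ring_scope.

(* A nonzero step size is by construction one whose next iterate improves the
   objective.  The step sizes of successive passes strictly decrease, and the
   first one is at most the minimum of k and n - k with k = norm0 (x 1) <= s;
   this minimum is at most s, and at most s - 1 when n < 2 s. *)

Lemma SS_le (R : realType) (n : nat) (A B : 'M[R]_n) (rule : sa_rule R n)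
    (gba : 'cV[R]_n -> 'cV[R]_n) (x : 'cV[R]_n) (k : nat) :
  (SS A B rule gba x k <= k)%N.
Proof. by elim: k => //= k IHk; case: ifP => // _; apply: leqW. Qed.

Lemma SS_improves (R : realType) (n : nat) (A B : 'M[R]_n) (rule : sa_rule R n)
    (gba : 'cV[R]_n -> 'cV[R]_n) (x : 'cV[R]_n) (k : nat) :
  SS A B rule gba x k != 0%N ->
  rayleigh A B x < rayleigh A B (gba (SA rule x (SS A B rule gba x k))).
Proof. by elim: k => //= k IHk; case: ifP => [_|/negbT]; rewrite -?ltNge. Qed.

Lemma executedS (r : nat -> nat) (t : nat) :
  (0 < t)%N -> executed r t.+1 -> executed r t /\ r t != 0%N.
Proof.
move=> t_gt0 [_ rn0]; split; last by apply: rn0; rewrite t_gt0 ltnSn.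
by split=> // u /andP[u_gt0 ltut]; apply: rn0; rewrite u_gt0 ltnW.
Qed.

(** A further pass requires the previous value of [r] to be nonzero, so the truncated predecessor is
    a strict drop. Starting from at most [m], zero is reached after at most [m] drops, hence the
    bound [m.+1]. *)
Lemma stops_at_decreasing (r : nat -> nat) (m : nat) :
  (executed r 1 -> (r 1 <= m)%N) ->
  (forall t, (0 < t)%N -> executed r t.+1 -> (r t.+1 <= (r t).-1)%N) ->
  exists2 T, stops_at r T & (T <= m.+1)%N.
Proof.
move=> r1_le r_decr.
have r_le k : executed r k.+1 -> (r k.+1 + k <= m)%N.
  elim: k => [|k IHk] exk; first by rewrite addn0; apply: r1_le.
  have [exk' rk_n0] := executedS _ k.+1 isT exk.
  apply: leq_trans (IHk exk'); rewrite addnS -addSn leq_add2r.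
  by rewrite -(prednK (n := r k.+1)) ?lt0n // ltnS r_decr.
have exT : exists T, (0 < T <= m.+1)%N && (r T == 0%N).
  (* Without a zero up to [m.+1], pass [m.+1] would be executed, and [r_le] at [k = m] leaves no
     value but zero there. *)
  apply/not_existsP => noT.
  have rn0 u : (0 < u <= m.+1)%N -> r u != 0%N.
    by move=> ule; apply/negP => ru0; apply: (noT u); rewrite ule.
  have exm : executed r m.+1.
    by split=> // u /andP[u_gt0 /ltnW ule]; apply: rn0; rewrite u_gt0.
  have := rn0 m.+1; rewrite /= leqnn -leqn0 => /(_ isT)/negP; apply.
  by have := r_le m exm; rewrite addnC -leq_subRL // subnn.
(* Taking the least zero makes pass [T] executed: no earlier pass has met the stopping criterion. *)
have [T /andP[/andP[T_gt0 leT] /eqP rT0] minT] := ex_minnP exT.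
exists T => //; split=> //; split=> // u /andP[u_gt0 ltuT].
apply/negP => ru0; have := minT u.
by rewrite u_gt0 ru0 (leq_trans (ltnW ltuT) leT) leqNgt ltuT => /(_ isT).
Qed.

Theorem theorem4p1 (R : realType) (n : nat) (A B : 'M[R]_n) (s : nat)
    (rule : sa_rule R n) (gba : 'cV[R]_n -> 'cV[R]_n)
    (xh x : nat -> 'cV[R]_n) (r : nat -> nat)
    (hA : psd A) (hB : posdef B) (hs : (1 <= s <= n)%N)
    (hrule : sa_rule_valid A B rule) (hgba : is_gba A B s gba)
    (hrun : sa_gba_run A B s rule gba xh x r) :
  (forall t : nat, (0 < t)%N -> executed r t.+1 ->
     rayleigh A B (x t) < rayleigh A B (x t.+1)) /\
  (exists T : nat, [/\ stops_at r T, (T <= s.+1)%N &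
     (n < s.*2)%N -> (T <= s)%N]).
Proof.
case: hrun => feas0 run; split.
  move=> t t_gt0 ext1; have [ext rt_n0] := executedS _ _ t_gt0 ext1.
  (* Unfolding both passes shows that [x t.+1] is the very point that [SS] compared with [x t] when
     it accepted [r t]. *)
  have [xE _ _] := run _ ext1; have [_ rE xhE] := run _ ext.
  by rewrite xE /= xhE rE SS_improves // -rE.
pose k := norm0 (gba (xh 0%N)).
have k_le : (k <= s)%N by have [[]] := hgba _ feas0.
have [||T stopT leT] := stops_at_decreasing r (minn k (n - k)).
- by move=> ex1; have [xE -> _] := run _ ex1; rewrite /k -xE; apply: SS_le.
- move=> t t_gt0 ext1; have [_ -> _] := run _ ext1.
  apply: leq_trans (SS_le _ _ _ _ _ _ _ _) _.
  (* From the second pass on, [rhat] is capped by the predecessor of the last step size. *)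
  by rewrite /rhat eqSS eqn0Ngt t_gt0 /= geq_minl.
exists T; split=> //; first by apply: leq_trans leT _; rewrite ltnS geq_min k_le.
move=> lt_n_2s; apply: leq_trans leT _.
(* If [k < s], the first term of the minimum is below [s]; if [k = s], the second one is [n - s],
   below [s] because [n < s.*2]. *)
rewrite gtn_min; case: (ltngtP k s) k_le => //= -> _.
by rewrite ltn_subLR ?addnn //; case/andP: hs.
Qed.
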